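(* Let $f,g$ be smooth functions on an open subset of $\mathbb{R}^2$, let $p$ be a fixed point of the system $\frac{dx^1}{dt}=f(x^1,x^2)$, $\frac{dx^2}{dt}=g(x^1,x^2)$ (that is, $f(p)=g(p)=0$), let $A=\begin{pmatrix}f_1&f_2\\ g_1&g_2\end{pmatrix}\Big|_{p}$, and let $\Delta=(\mathrm{tr}\,A)^2-4\det A$. 1. If $p$ is a Jacobi stable fixed point, then $\Delta<0$. 2. If $\Delta<0$, write the eigenvalues of $A$ as $\lambda_{1,2}=\alpha\pm i\beta$ with $\alpha,\beta\in\mathbb{R}$. Then: (i) if $\alpha^2-\beta^2>0$, then $p$ is Jacobi unstable; (ii) if $\alpha^2-\beta^2<0$, then $p$ is Jacobi stable.
   Context: Subscripts denote partial derivatives: $f_i=\partial f/\partial x^i$, $g_i=\partial g/\partial x^i$. Repeated indices are summed. For a system of second order ODEs $\frac{d^2x^i}{dt^2}+2G^i(x,y,t)=0$, $y^i=dx^i/dt$, with $G^i$ smooth, set $N^i_j=\partial G^i/\partial y^j$, $G^i_{jl}=\partial N^i_j/\partial y^l$. The curvature deviation tensor is $$P^i_j=-2\frac{\partial G^i}{\partial x^j}-2G^lG^i_{jl}+y^l\frac{\partial N^i_j}{\partial x^l}+N^i_lN^l_j+\frac{\partial N^i_j}{\partial t},$$ with $x^i,y^i,t$ treated as independent variables. To the first order system $\dot x^1=f$, $\dot x^2=g$ one associates the second order system obtained by differentiating in $t$: $\ddot x^1=f_1y^1+f_2y^2$, $\ddot x^2=g_1y^1+g_2y^2$, i.e. $G^1=-\frac12(f_1y^1+f_2y^2)$,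 $G^2=-\frac12(g_1y^1+g_2y^2)$, and takes $P=(P^i_j)$ to be its curvature deviation tensor. At a fixed point $p$ one has $y=(f(p),g(p))=(0,0)$, and $P|_p$ denotes $P$ evaluated at $x=p$, $y=0$. The fixed point $p$ is called Jacobi stable if the real parts of the eigenvalues of the matrix $P|_p$ are all strictly negative, and Jacobi unstable otherwise. *)

(* Defs.v *)
From mathcomp Require Import all_boot all_order all_algebra.
From mathcomp Require Import all_classical all_reals all_analysis.
From mathcomp Require Import complex.

Set Implicit Arguments.
Unset Strict Implicit.
Unset Printing Implicit Defensive.

Import Order.TTheory GRing.Theory Num.Theory.
Import numFieldNormedType.Exports.

Local Open Scope classical_set_scope.
Local Open Scope ring_scope.

Definition partial (R : realType) (n : nat) (j : 'I_n) (h : 'rV[R]_n -> R)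
    (x : 'rV[R]_n) : R :=
  'D_(delta_mx 0 j) h x.

Definition iter_partial (R : realType) (n : nat) (s : seq 'I_n)
    (h : 'rV[R]_n -> R) : 'rV[R]_n -> R :=
  foldr (@partial R n) h s.

(* C^oo on U; [h] is total, but for U open its values outside U are
   irrelevant. *)
Definition smooth_on (R : realType) (n : nat) (U : set 'rV[R]_n)
    (h : 'rV[R]_n -> R) : Prop :=
  forall (s : seq 'I_n) (x : 'rV[R]_n), U x ->
    {for x, continuous (iter_partial s h)} /\
    forall j : 'I_n, derivable (iter_partial s h) x (delta_mx 0 j).

(* Functions of (x, y, t), the three groups of variables being independent. *)
Definition xyt_fun (R : realType) (n : nat) : Type :=
  'rV[R]_n -> 'rV[R]_n -> R -> R.

Definition dx (R : realType) (n : nat) (j : 'I_n) (H : xyt_fun R n) :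
    xyt_fun R n :=
  fun x y t => partial j (fun x' => H x' y t) x.

Definition dy (R : realType) (n : nat) (j : 'I_n) (H : xyt_fun R n) :
    xyt_fun R n :=
  fun x y t => partial j (fun y' => H x y' t) y.

Definition dt (R : realType) (n : nat) (H : xyt_fun R n) : xyt_fun R n :=
  fun x y t => derive1 (fun t' : R => H x y t') t.

Section SecondOrder.
Variables (R : realType) (n : nat).

(* G encodes the system x''^i + 2 G^i(x, x', t) = 0. *)
Variable G : 'I_n -> xyt_fun R n.

Definition Ncoef (i j : 'I_n) : xyt_fun R n := dy j (G i).

Definition Gcoef (i j l : 'I_n) : xyt_fun R n := dy l (Ncoef i j).

Definition deviation_tensor (x y : 'rV[R]_n) (t : R) : 'M[R]_n :=
  \matrix_(i, j)
    (- 2 * dx j (G i) x y t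
     - 2 * (\sum_(l < n) G l x y t * Gcoef i j l x y t)
     + \sum_(l < n) y 0 l * dx l (Ncoef i j) x y t
     + \sum_(l < n) Ncoef i l x y t * Ncoef l j x y t
     + dt (Ncoef i j) x y t).

End SecondOrder.

(* Differentiating x'^i = F^i(x) in t gives x''^i = \sum_l (d_l F^i)(x) y^l. *)
Definition differentiated_G (R : realType) (n : nat)
    (F : 'I_n -> 'rV[R]_n -> R) (i : 'I_n) : xyt_fun R n :=
  fun x y _ => - 2^-1 * \sum_(l < n) partial l (F i) x * y 0 l.

Definition planar_field (R : realType) (f g : 'rV[R]_2 -> R) (i : 'I_2) :
    'rV[R]_2 -> R :=
  if i == 0 then f else g.

Definition jacobian_matrix (R : realType) (f g : 'rV[R]_2 -> R)
    (p : 'rV[R]_2) : 'M[R]_2 :=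
  \matrix_(i, j) partial j (planar_field f g i) p.

Definition deviation_at (R : realType) (f g : 'rV[R]_2 -> R)
    (p : 'rV[R]_2) (t : R) : 'M[R]_2 :=
  deviation_tensor (differentiated_G (planar_field f g)) p 0 t.

Lemma deviation_at_autonomous (R : realType) (f g : 'rV[R]_2 -> R)
    (p : 'rV[R]_2) (t : R) : deviation_at f g p t = deviation_at f g p 0.
Proof. by []. Qed.

(* The complex eigenvalues of a real matrix. *)
Definition complex_eigenvalue (R : realType) (n : nat) (M : 'M[R]_n)
    (z : R[i]) : bool :=
  eigenvalue (map_mx (real_complex R) M) z.

(* The time t = 0 is immaterial, by [deviation_at_autonomous]. *)
Definition jacobi_stable (R : realType) (f g : 'rV[R]_2 -> R)
    (p : 'rV[R]_2) : Prop :=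
  forall z : R[i], complex_eigenvalue (deviation_at f g p 0) z ->
    complex.Re z < 0.

Definition jacobi_unstable (R : realType) (f g : 'rV[R]_2 -> R)
    (p : 'rV[R]_2) : Prop :=
  ~ jacobi_stable f g p.

(* Main.v *)
Require Import Defs.
From mathcomp Require Import all_boot all_order all_algebra.
From mathcomp Require Import all_classical all_reals all_analysis.
From mathcomp Require Import complex.
From mathcomp Require Import ring.

Import Order.TTheory GRing.Theory Num.Theory.
Import numFieldNormedType.Exports.

Local Open Scope classical_set_scope.
Local Open Scope ring_scope.

(** The curvature deviation tensor P of a differentiated system is easy to find
    at an equilibrium, where y = 0.  Since G is linear in y, it vanishes there
    together with its x-derivatives, and [Ncoef] is minus half the Jacobian
    matrix of the field.  The x-derivatives of [Ncoef] enter only with a factor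
    y, and its time derivative is 0 by autonomy; what remains is the
    product of [Ncoef] with itself.  Hence P = (A / 2) ^ 2, with A the Jacobian
    matrix at the equilibrium ([deviation_tensor_at_rest]), and the eigenvalues
    of P are the numbers (w / 2) ^ 2 for w an eigenvalue of A
    ([eigenvalue_sqr]).  Jacobi stability therefore says that Re (w ^ 2) < 0 for
    every eigenvalue w of A ([jacobi_stableP]).

    Both parts of the theorem are read off from this criterion.  A real w has
    w ^ 2 >= 0, so a stable equilibrium excludes real eigenvalues of A, and a
    real 2 x 2 matrix without real eigenvalues has negative discriminant
    ([real_eigenvalue_disc_ge0]).  For w = alpha +- i beta the real part of
    w ^ 2 is alpha ^ 2 - beta ^ 2. *)

Lemma partial_linear_form (R : realType) (n : nat) (c : R) (a : 'I_n -> R)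
    (j : 'I_n) (y : 'rV[R]_n) :
  partial j (fun y' => c * \sum_(l < n) a l * y' 0 l) y = c * a j.
Proof.
rewrite /partial /derive; apply: cvg_lim => //.
(* The difference quotient is constant away from the step h = 0. *)
apply: cvg_near_cst; near=> h.
have h0 : h != 0 by near: h; exact: nbhs_dnbhs_neq.
rewrite -mulrBr -sumrB (bigD1 j) //= big1 => [|l lj]; last first.
  by rewrite !mxE eqxx (negbTE lj) mulr0 add0r subrr.
rewrite !mxE !eqxx mulr1 addr0 -mulrBr addrK /GRing.scale /=.
by field.
Unshelve. all: by end_near.
Qed.

Lemma deviation_tensor_at_rest (R : realType) (n : nat)
    (F : 'I_n -> 'rV[R]_n -> R) (p : 'rV[R]_n) (t : R) :
  let A := \matrix_(i, j) partial j (F i) p in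
  deviation_tensor (differentiated_G F) p 0 t = (2^-1 *: A) *m (2^-1 *: A).
Proof.
move=> A; set G := differentiated_G F.
have G0 i x : G i x 0 = fun=> 0.
  apply/funext => s; rewrite /G /differentiated_G big1 ?mulr0 // => l _.
  by rewrite mxE mulr0.
have NE i j x y s : Ncoef G i j x y s = - 2^-1 * partial j (F i) x.
  exact: partial_linear_form.
apply/matrixP => i j; rewrite !mxE.
have -> : dx j (G i) p 0 t = 0.
  rewrite /dx (_ : (fun x' => _) = cst 0) ?/partial ?derive_cst //.
  by apply/funext => x; rewrite G0.
rewrite [X in _ - _ * X + _ + _ + _]big1 => [|l _]; last by rewrite G0 mul0r.
rewrite [X in _ + X + _ + _]big1 => [|l _]; last by rewrite mxE mul0r.
have -> : dt (Ncoef G i j) p 0 t = 0.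
  rewrite /dt (_ : (fun t' => _) = cst (- 2^-1 * partial j (F i) p)).
    exact: derive1_cst.
  by apply/funext => s; rewrite NE.
rewrite !mulr0 subr0 !add0r addr0; apply: eq_bigr => l _.
by rewrite !NE !mxE !mulNr mulrN opprK.
Qed.

(** If v is an eigenvector of B ^ 2 for w ^ 2, then v (B - w) (B + w) = 0:
    either v is an eigenvector of B for w, or v (B - w) is one for - w. *)
Lemma eigenvalue_sqr (F : fieldType) (n : nat) (B : 'M[F]_n) (w : F) :
  eigenvalue (B *m B) (w ^+ 2) = eigenvalue B w || eigenvalue B (- w).
Proof.
have sqr_eigen a : eigenvalue B a -> eigenvalue (B *m B) (a ^+ 2).
  move=> /eigenvalueP[v vB v0]; apply/eigenvalueP; exists v => //.
  by rewrite mulmxA vB -scalemxAl vB scalerA.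
apply/idP/orP => [/eigenvalueP[v vBB v0] | []/sqr_eigen] //; last first.
  by rewrite sqrrN.
have [/eqP|u0] := eqVneq (v *m B - w *: v) 0.
  by rewrite subr_eq0 => /eqP vB; left; apply/eigenvalueP; exists v.
right; apply/eigenvalueP; exists (v *m B - w *: v) => //.
rewrite mulmxBl -mulmxA vBB -scalemxAl expr2 scalerBr !scalerA mulNr !scaleNr.
by rewrite opprK addrC.
Qed.

Lemma eigenvalueZ (F : fieldType) (n : nat) (B : 'M[F]_n) (c a : F) :
  c != 0 -> eigenvalue (c *: B) (c * a) = eigenvalue B a.
Proof.
move=> c0; apply/eigenvalueP/eigenvalueP => -[v vB v0]; exists v => //.
  by apply: (scalerI c0); rewrite scalemxAr vB scalerA.
by rewrite -scalemxAr vB scalerA.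
Qed.

(** Spectral mapping through P = (A / 2) ^ 2; halving w does not change the sign
    of the real part of w ^ 2. *)
Lemma jacobi_stableP (R : realType) (f g : 'rV[R]_2 -> R) (p : 'rV[R]_2) :
  jacobi_stable f g p <->
  forall w : R[i], complex_eigenvalue (jacobian_matrix f g p) w ->
    complex.Re (w ^+ 2) < 0.
Proof.
rewrite /jacobi_stable /complex_eigenvalue /deviation_at.
rewrite deviation_tensor_at_rest -/(jacobian_matrix f g p) map_mxM map_mxZ.
set B := map_mx _ _; pose c : R[i] := real_complex R 2^-1.
have c0 : c != 0 by rewrite fmorph_eq0 invr_eq0 pnatr_eq0.
have ReE w : (complex.Re ((c * w) ^+ 2) < 0) = (complex.Re (w ^+ 2) < 0).
  rewrite exprMn -rmorphXn; case: (w ^+ 2) => a b /=.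
  by rewrite mul0r subr0 pmulr_rlt0 // exprn_gt0 // invr_gt0.
have half w : eigenvalue (c *: B) (c * w) = eigenvalue B w.
  exact: eigenvalueZ.
split=> [P_lt0 w Bw | A_lt0 z].
  by rewrite -ReE; apply: P_lt0; rewrite eigenvalue_sqr half Bw.
(* Every complex z is the square of half some w. *)
have -> : z = (c * (c^-1 * sqrtc z)) ^+ 2 by rewrite mulVKf // sqr_sqrtc.
rewrite eigenvalue_sqr -mulrN !half ReE => /orP[/A_lt0 // | /A_lt0].
by rewrite sqrrN.
Qed.

Lemma det_mx2 (K : comNzRingType) (A : 'M[K]_2) :
  \det A = A 0 0 * A 1 1 - A 0 1 * A 1 0.
Proof.
rewrite (expand_det_row _ 0) !big_ord_recl big_ord0 /cofactor !det_mx11 !mxE /=.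
rewrite expr0 expr1 mul1r mulN1r addr0 mulrN.
by congr (A _ _ * A _ _ - A _ _ * A _ _); apply/val_inj.
Qed.

(** The root (tr A + sqrt disc) / 2 of the characteristic polynomial is real. *)
Lemma real_eigenvalue_disc_ge0 (R : rcfType) (A : 'M[R]_2) :
  0 <= (\tr A) ^+ 2 - 4 * \det A -> exists a : R, eigenvalue A a.
Proof.
move=> disc_ge0; set a := (\tr A + Num.sqrt ((\tr A) ^+ 2 - 4 * \det A)) / 2.
exists a; have /eqP/det0P[v v0 vA] : \det (A - a%:M) = 0.
  have := sqr_sqrtr disc_ge0; rewrite {}/a; move: (Num.sqrt _) => s sE.
  move: sE; rewrite !det_mx2 /mxtrace !big_ord_recl big_ord0 !mxE /=.
  rewrite (_ : lift 0 0 = 1); last exact: val_inj.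
  rewrite !mulr1n !mulr0n => sE.
  by field: sE.
apply/eigenvalueP; exists v => //.
by apply/eqP; rewrite -subr_eq0 -mul_mx_scalar -mulmxBr vA.
Qed.

Theorem theorem4p1 (R : realType) (U : set 'rV[R]_2) (f g : 'rV[R]_2 -> R)
    (p : 'rV[R]_2)
    (openU : open U) (smooth_f : smooth_on U f) (smooth_g : smooth_on U g)
    (Up : U p) (fp0 : f p = 0) (gp0 : g p = 0) :
  let A := jacobian_matrix f g p in
  let Delta := (\tr A) ^+ 2 - 4 * \det A in
  (jacobi_stable f g p -> Delta < 0) /\
  (Delta < 0 ->
   forall alpha beta : R,
     (forall z : R[i], complex_eigenvalue A z <->
        z = (alpha +i* beta)%C \/ z = (alpha -i* beta)%C) ->
     (alpha ^+ 2 - beta ^+ 2 > 0 -> jacobi_unstable f g p) /\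
     (alpha ^+ 2 - beta ^+ 2 < 0 -> jacobi_stable f g p)).
Proof.
move=> A Delta; split=> [/jacobi_stableP stable | _ alpha beta spec].
  rewrite ltNge; apply/negP => /real_eigenvalue_disc_ge0[a Aa].
  have := stable a%:C%C; rewrite /complex_eigenvalue eigenvalue_map => /(_ Aa).
  by rewrite -rmorphXn /= ltNge sqr_ge0.
have Re_sqr (b : R) : complex.Re ((alpha +i* b)%C ^+ 2) = alpha ^+ 2 - b ^+ 2.
  by rewrite !expr2.
split=> [gt0 /jacobi_stableP stable | lt0].
  have /stable : complex_eigenvalue A (alpha +i* beta)%C.
    by apply/spec; left.
  by rewrite Re_sqr ltNge ltW.
apply/jacobi_stableP => w /spec[] ->; rewrite Re_sqr //.
by rewrite sqrrN.
Qed.
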